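(* Let $\mathbf{X}=(X,d,A,\alpha)$ and $\mathbf{Y}=(Y,e,B,\beta)$ be effective metric spaces, let $D\subseteq X$ and $\theta:D\to Y$. Suppose the sets $$\left\{(p,q,r)\,\middle|\, p,q\in\mathrm{dom}(\alpha),\ r\in\mathbb{N},\ d(\alpha(p),\alpha(q))<\tfrac{1}{2r+2}\right\},\quad \left\{(p,q,r)\,\middle|\, p,q\in\mathrm{dom}(\beta),\ r\in\mathbb{N},\ e(\beta(p),\beta(q))<\tfrac{1}{2r+2}\right\}$$ are recursively enumerable subsets of $\mathbb{N}^3$, and suppose $\theta$ is $(\delta_\mathbf{X},\delta_\mathbf{Y})$-computable. Then there exists an $A,B$-approximation system $S$ for $\theta$ which is recursively enumerable with respect to $\alpha$ and $\beta$.
   Context: Here $\mathbb{N}=\{0,1,2,\dots\}$. An effective metric space $\mathbf{X}=(X,d,A,\alpha)$ consists of a metric space $(X,d)$ (not necessarily complete, with no effectivity requirement on $d$), a countable dense subset $A\subseteq X$, and a notation $\alpha$ of $A$, regarded here as a surjective map from some subset $\mathrm{dom}(\alpha)\subseteq\mathbb{N}$ onto $A$; similarly for $\mathbf{Y}=(Y,e,B,\beta)$. A Cauchy name of $\xi\in X$ is a total function $f:\mathbb{N}\to\mathbb{N}$ with $f(i)\in\mathrm{dom}(\alpha)$ for all $i$, $d(\alpha(f(i)),\alpha(f(k)))\le 2^{-i}$ for all $i<k$, and $\xi=\lim_{i\to\infty}\alpha(f(i))$ ($\delta_\mathbf{X}$ denotes the resulting Cauchy representation; similarly $\delta_\mathbf{Y}$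 for $Y$ via $\beta$). The function $\theta$ is $(\delta_\mathbf{X},\delta_\mathbf{Y})$-computable if there is a recursive (computable) operator $T$ mapping unary partial functions on $\mathbb{N}$ to unary partial functions on $\mathbb{N}$ such that whenever $f$ is a Cauchy name of some $\xi\in D$, $T(f)$ is a Cauchy name of $\theta(\xi)$. An $A,B$-approximation system for $\theta$ is a set $S\subseteq A\times\mathbb{N}\times B\times\mathbb{N}$ such that for every $\xi\in D$: (1) whenever $(a,m,b,n)\in S$ and $d(a,\xi)<\frac{1}{m+1}$, then $e(b,\theta(\xi))<\frac{1}{n+1}$; (2) for every $n\in\mathbb{N}$ there exists $m\in\mathbb{N}$ such that for every $a\in A$ with $d(a,\xi)<\frac{1}{m+1}$ there is some $b$ with $(a,m,b,n)\in S$. The set $S$ is recursively enumerable with respect to $\alpha$ and $\beta$ if $\hat S=\{(i,m,j,n)\mid i\in\mathrm{dom}(\alpha),\ j\in\mathrm{dom}(\beta),\ (\alpha(i),m,\beta(j),n)\in S\}$ is a recursively enumerable subset of $\mathbb{N}^4$. *)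

(* Defs.v *)
From mathcomp Require Import all_boot all_order all_algebra.
From mathcomp Require Import all_classical all_reals all_analysis.

Set Implicit Arguments.
Unset Strict Implicit.
Unset Printing Implicit Defensive.

Import Order.TTheory GRing.Theory Num.Theory.
Import numFieldNormedType.Exports.

Local Open Scope classical_set_scope.
Local Open Scope ring_scope.

Section Computability.
Local Open Scope nat_scope.

(* Kleene's total recursive functions: minimization is only applied to
   functions having a zero for all values of the parameters. *)
Inductive recursive : forall k, (k.-tuple nat -> nat) -> Prop :=
| recursive_zero : recursive (fun _ : 0.-tuple nat => 0)
| recursive_succ : recursive (fun v : 1.-tuple nat => (thead v).+1)
| recursive_proj k (i : 'I_k) : recursive (fun v : k.-tuple nat => tnth v i)
| recursive_comp k m (f : m.-tuple nat -> nat)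
    (h : 'I_m -> k.-tuple nat -> nat) :
    recursive f -> (forall i, recursive (h i)) ->
    recursive (fun v : k.-tuple nat => f [tuple h i v | i < m])
| recursive_primrec k (f : k.-tuple nat -> nat) (g : k.+2.-tuple nat -> nat)
    (h : k.+1.-tuple nat -> nat) :
    recursive f -> recursive g ->
    (forall v : k.-tuple nat, h [tuple of 0 :: v] = f v) ->
    (forall n (v : k.-tuple nat), h [tuple of n.+1 :: v] =
       g [tuple of n :: h [tuple of n :: v] :: v]) ->
    recursive h
| recursive_mu k (f : k.+1.-tuple nat -> nat) (h : k.-tuple nat -> nat) :
    recursive f ->
    (forall v : k.-tuple nat, f [tuple of h v :: v] = 0 /\
       forall j, j < h v -> f [tuple of j :: v] <> 0) ->
    recursive h.

Definition recursively_enumerable k (S : set (k.-tuple nat)) : Prop :=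
  S = set0 \/
  exists g : nat -> k.-tuple nat,
    (forall i : 'I_k,
        recursive (fun v : 1.-tuple nat => tnth (g (thead v)) i)) /\
    S = range g.

(* Cantor's bijection between pairs of natural numbers and natural numbers. *)
Definition cantor_pair (x y : nat) : nat := ((x + y) * (x + y).+1)./2 + x.

(* The finite set with canonical index z: z is the sum of 2 ^ x over its
   elements x. *)
Definition canonical_finite_set (z : nat) : set nat :=
  [set x | odd (z %/ 2 ^ x)].

Definition partial_graph (f : nat -> option nat) : set nat :=
  [set w | exists x y, w = cantor_pair x y /\ f x = Some y].

(* A unary partial function is an element of nat -> option nat.  A recursive
   operator is an enumeration operator that sends (graphs of) partial functions
   to (graphs of) partial functions; it is given by a recursively enumerable
   set W of triples (z, x, y), read as "if the finite set with canonical index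
   z is contained in the graph of the argument, then the value at x is y". *)
Definition recursive_operator (T : (nat -> option nat) -> nat -> option nat)
    : Prop :=
  exists2 W : set (3.-tuple nat), recursively_enumerable W &
    forall (f : nat -> option nat) (x y : nat),
      T f x = Some y <->
      exists2 z, W [tuple z; x; y] & canonical_finite_set z `<=` partial_graph f.

End Computability.

(* The notation is a partial map from nat onto the dense set; its domain is the
   set of all i with notation i <> None.  Option values (rather than junk
   values) allow the underlying space to be empty. *)
Record effectiveMetricSpace (R : realType) := EffectiveMetricSpace {
  ems_carrier :> metricType R;
  ems_dense : set ems_carrier;
  ems_notation : nat -> option ems_carrier;
  ems_denseP : dense ems_dense;
  ems_countable : countable ems_dense;
  ems_notation_onto : ems_dense = [set a | exists i, ems_notation i = Some a]
}.
Arguments ems_dense {R} X _ : rename.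
Arguments ems_notation {R} X _ : rename.

Definition cauchy_name (R : realType) (X : effectiveMetricSpace R)
    (f : nat -> nat) (xi : X) : Prop :=
  exists x : nat -> X,
    [/\ forall i, ems_notation X (f i) = Some (x i),
        forall i k, (i < k)%N -> mdist (x i) (x k) <= 2 ^- i
      & x @ \oo --> xi].

Definition representation_computable (R : realType)
    (X Y : effectiveMetricSpace R) (D : set X) (theta : D -> Y) : Prop :=
  exists2 T, recursive_operator T &
    forall (xi : D) (f : nat -> nat), cauchy_name f (val xi) ->
      exists2 g : nat -> nat,
        T (fun i => Some (f i)) = (fun i => Some (g i)) &
        cauchy_name g (theta xi).

Definition approximation_system (R : realType)
    (X Y : effectiveMetricSpace R) (D : set X) (theta : D -> Y)
    (S : set (X * nat * Y * nat)) : Prop :=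
  (forall a m b n, S (a, m, b, n) -> ems_dense X a /\ ems_dense Y b) /\
  forall xi : D,
    (forall a m b n, S (a, m, b, n) ->
       mdist a (val xi) < m.+1%:R^-1 -> mdist b (theta xi) < n.+1%:R^-1) /\
    (forall n, exists m, forall a, ems_dense X a ->
       mdist a (val xi) < m.+1%:R^-1 -> exists b, S (a, m, b, n)).

Definition index_set (R : realType) (X Y : effectiveMetricSpace R)
    (S : set (X * nat * Y * nat)) : set (4.-tuple nat) :=
  [set t | exists i m j n a b,
     [/\ t = [tuple i; m; j; n], ems_notation X i = Some a,
         ems_notation Y j = Some b & S (a, m, b, n)]].

Definition close_indices (R : realType) (X : effectiveMetricSpace R)
    : set (3.-tuple nat) :=
  [set t | exists p q r a b,
     [/\ t = [tuple p; q; r], ems_notation X p = Some a,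
         ems_notation X q = Some b & mdist a b < (2 * r + 2)%N%:R^-1]].

(* Main.v *)
(* If a finite sequence p_0, ..., p_z of indices satisfies
   d(alpha(p_k), a) < 2^-(k+2) and 2^(z+2) <= m+1, then it extends to a Cauchy
   name of every xi with d(a, xi) < 1/(m+1).  So if the operator needs only the
   values p_0, ..., p_z to produce the index y at a position x with
   2^x >= 2n+2, then beta(y) is within 1/(2n+2) of theta(xi), and so every b
   closer than 1/(2n+2) to beta(y) is within 1/(n+1) of theta(xi).  The
   quadruples (a, m, b, n) obtained in this way form S: membership depends only
   on the points a and b, through strict inequalities between distances, and is
   therefore semidecidable in terms of any of their indices. *)
Require Import Defs.
From mathcomp Require Import all_boot all_order all_algebra.
From mathcomp Require Import all_classical all_reals all_analysis.
From mathcomp Require Import zify.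

Set Implicit Arguments.
Unset Strict Implicit.
Unset Printing Implicit Defensive.

Import Order.TTheory GRing.Theory Num.Theory.
Import numFieldNormedType.Exports.

Local Open Scope classical_set_scope.

(** * Recursive functions *)

Lemma eq_recursive k (f g : k.-tuple nat -> nat) :
  f =1 g -> recursive f -> recursive g.
Proof. by move/funext->. Qed.

(** Recursiveness of a tuple-valued map is taken componentwise, so that substitution can be stated
    without the [mktuple] form built into [recursive_comp]. *)
Definition recursive_map k m (h : k.-tuple nat -> m.-tuple nat) : Prop :=
  forall i, recursive (fun v => tnth (h v) i).

Lemma recursive_app k m (f : m.-tuple nat -> nat)
    (h : k.-tuple nat -> m.-tuple nat) :
  recursive f -> recursive_map h -> recursive (fun v => f (h v)).
Proof.
move=> rf rh; apply: eq_recursive (recursive_comp rf rh) => v.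
by congr f; apply: eq_from_tnth => i; rewrite tnth_mktuple.
Qed.

Lemma recursive_map_nil {k} : recursive_map (fun _ : k.-tuple nat => [tuple]).
Proof. by case. Qed.

Lemma recursive_map_cons k m (a : k.-tuple nat -> nat)
    (h : k.-tuple nat -> m.-tuple nat) :
  recursive a -> recursive_map h ->
  recursive_map (fun v => [tuple of a v :: h v]).
Proof.
move=> ra rh i; case: (unliftP ord0 i) => [j|] ->.
  by apply: eq_recursive (rh j) => v; rewrite tnthS.
by apply: eq_recursive ra => v; rewrite tnth0.
Qed.

Lemma recursive_map_id {k} : recursive_map (fun v : k.-tuple nat => v).
Proof. by move=> i; exact: recursive_proj. Qed.

Lemma recursive_map_behead k m (h : k.-tuple nat -> m.+1.-tuple nat) :
  recursive_map h -> recursive_map (fun v => [tuple of behead (h v)]).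
Proof.
move=> rh i; apply: eq_recursive (rh (lift ord0 i)) => v.
by rewrite [X in tnth X (lift _ _)](tuple_eta (h v)) tnthS.
Qed.

Lemma recursive_thead k m (h : k.-tuple nat -> m.+1.-tuple nat) :
  recursive_map h -> recursive (fun v => thead (h v)).
Proof. by move=> /(_ ord0). Qed.

Lemma recursive_const {k} c : recursive (fun _ : k.-tuple nat => c).
Proof.
elim: c => [|c IHc]; first exact: (recursive_app recursive_zero (@recursive_map_nil k)).
exact: (recursive_app recursive_succ (recursive_map_cons IHc (@recursive_map_nil k))).
Qed.

Lemma recursive_app1 k (F : nat -> nat) (a : k.-tuple nat -> nat) :
  recursive (fun v : 1.-tuple nat => F (thead v)) -> recursive a ->
  recursive (fun v => F (a v)).
Proof.
by move=> rF ra; exact: (recursive_app rF (recursive_map_cons ra (@recursive_map_nil k))).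
Qed.

Lemma recursiveS k (a : k.-tuple nat -> nat) :
  recursive a -> recursive (fun v => (a v).+1).
Proof. exact: (recursive_app1 recursive_succ). Qed.

(** The recursion variable is first an extra leading coordinate, as in Kleene's scheme, and [a v] is
    then substituted for it. The step function receives a tuple laid out as counter, previous value,
    parameters. *)
Lemma recursive_nat_rect k (f : k.-tuple nat -> nat)
    (g : nat -> nat -> k.-tuple nat -> nat) (a : k.-tuple nat -> nat) :
  recursive f ->
  recursive (fun v : k.+2.-tuple nat => g (thead v) (thead [tuple of behead v])
    [tuple of behead [tuple of behead v]]) ->
  recursive a ->
  recursive (fun v => nat_rect (fun=> nat) (f v) (fun n r => g n r v) (a v)).
Proof.
move=> rf rg ra; pose h (w : k.+1.-tuple nat) := nat_rect (fun=> nat)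
  (f [tuple of behead w]) (fun n r => g n r [tuple of behead w]) (thead w).
have beheadE m n (v : m.-tuple nat) : [tuple of behead [tuple of n :: v]] = v.
  exact: val_inj.
have rh : recursive h.
  apply: (recursive_primrec rf rg) => [v|n v]; first by rewrite /h beheadE.
  by rewrite /h !beheadE !theadE.
apply: eq_recursive (recursive_app rh (recursive_map_cons ra recursive_map_id)).
by move=> v; rewrite /h beheadE.
Qed.

(** * Closure under arithmetic operations *)

Lemma recursiveD k (a b : k.-tuple nat -> nat) :
  recursive a -> recursive b -> recursive (fun v => a v + b v).
Proof.
move=> ra rb.
have := recursive_nat_rect (g := fun _ r _ => r.+1) rb _ ra.
have rg : recursive (fun v : k.+2.-tuple nat => (thead [tuple of behead v]).+1).
  by apply/recursiveS/recursive_thead/recursive_map_behead/recursive_map_id.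
move=> /(_ rg); apply: eq_recursive => v.
by elim: (a v) => //= n ->.
Qed.

Lemma recursiveM k (a b : k.-tuple nat -> nat) :
  recursive a -> recursive b -> recursive (fun v => a v * b v).
Proof.
move=> ra rb; have := recursive_nat_rect (g := fun _ r v => b v + r)
  (recursive_const 0) _ ra.
have rg : recursive (fun v : k.+2.-tuple nat =>
    b [tuple of behead [tuple of behead v]] + thead [tuple of behead v]).
  apply: recursiveD.
    by apply: recursive_app => //; do 2![apply: recursive_map_behead]; exact: recursive_map_id.
  by apply/recursive_thead/recursive_map_behead/recursive_map_id.
move=> /(_ rg); apply: eq_recursive => v.
by elim: (a v) => //= n ->; rewrite mulSn.
Qed.

Lemma recursive_exp k (a b : k.-tuple nat -> nat) :
  recursive a -> recursive b -> recursive (fun v => a v ^ b v).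
Proof.
move=> ra rb; have := recursive_nat_rect (g := fun _ r v => a v * r)
  (recursive_const 1) _ rb.
have rg : recursive (fun v : k.+2.-tuple nat =>
    a [tuple of behead [tuple of behead v]] * thead [tuple of behead v]).
  apply: recursiveM.
    by apply: recursive_app => //; do 2![apply: recursive_map_behead]; exact: recursive_map_id.
  by apply/recursive_thead/recursive_map_behead/recursive_map_id.
move=> /(_ rg); apply: eq_recursive => v.
by elim: (b v) => //= n ->; rewrite expnS.
Qed.

Lemma recursive_iter k (F : nat -> nat) (n a : k.-tuple nat -> nat) :
  recursive (fun v : 1.-tuple nat => F (thead v)) -> recursive n ->
  recursive a -> recursive (fun v => iter (n v) F (a v)).
Proof.
move=> rF rn ra; have := recursive_nat_rect (g := fun _ r _ => F r) ra _ rn.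
have rg : recursive (fun v : k.+2.-tuple nat => F (thead [tuple of behead v])).
  apply: recursive_app1 => //.
  by apply/recursive_thead/recursive_map_behead/recursive_map_id.
move=> /(_ rg); apply: eq_recursive => v.
by elim: (n v) => //= m ->.
Qed.

Lemma recursiveB k (a b : k.-tuple nat -> nat) :
  recursive a -> recursive b -> recursive (fun v => a v - b v).
Proof.
move=> ra rb.
have rpred : recursive (fun v : 1.-tuple nat => (thead v).-1).
  have := recursive_nat_rect (g := fun n _ (_ : 1.-tuple nat) => n)
    (recursive_const 0) (recursive_thead recursive_map_id)
    (recursive_thead recursive_map_id).
  by apply: eq_recursive => v; case: (thead v).
apply: eq_recursive (recursive_iter rpred rb ra) => v.
by elim: (b v) => [|n /= ->]; rewrite ?subn0 ?subnS.
Qed.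

(** * Predicates as functions with values 0 and 1, and bounded quantifiers *)

Lemma recursive_leq k (a b : k.-tuple nat -> nat) :
  recursive a -> recursive b -> recursive (fun v => a v <= b v).
Proof.
move=> ra rb.
apply: eq_recursive (recursiveB (recursive_const 1) (recursiveB ra rb)) => v.
by rewrite [(a v <= b v)%N]/leq; case: (a v - b v).
Qed.

Lemma recursive_negb k (P : k.-tuple nat -> bool) :
  recursive P -> recursive (fun v => ~~ P v).
Proof.
move=> rP; apply: eq_recursive (recursiveB (recursive_const 1) rP) => v.
by case: (P v).
Qed.

Lemma recursive_andb k (P Q : k.-tuple nat -> bool) :
  recursive P -> recursive Q -> recursive (fun v => P v && Q v).
Proof.
by move=> rP rQ; apply: eq_recursive (recursiveM rP rQ) => v; rewrite mulnb.
Qed.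

Lemma recursive_implyb k (P Q : k.-tuple nat -> bool) :
  recursive P -> recursive Q -> recursive (fun v => P v ==> Q v).
Proof.
move=> rP rQ; apply: eq_recursive (recursive_leq rP rQ) => v.
by case: (P v); case: (Q v).
Qed.

Lemma recursive_eqn k (a b : k.-tuple nat -> nat) :
  recursive a -> recursive b -> recursive (fun v => a v == b v).
Proof.
move=> ra rb; have := recursive_andb (recursive_leq ra rb) (recursive_leq rb ra).
by apply: eq_recursive => v; rewrite eqn_leq.
Qed.

Lemma recursive_if k (P : k.-tuple nat -> bool) (a b : k.-tuple nat -> nat) :
  recursive P -> recursive a -> recursive b ->
  recursive (fun v => if P v then a v else b v).
Proof.
move=> rP ra rb.
have := recursiveD (recursiveM rP ra) (recursiveM (recursive_negb rP) rb).
by apply: eq_recursive => v; case: (P v); rewrite ?mul0n ?mul1n ?addn0.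
Qed.

Lemma recursive_sum k (G : nat -> k.-tuple nat -> nat)
    (b : k.-tuple nat -> nat) :
  recursive (fun v : k.+1.-tuple nat => G (thead v) [tuple of behead v]) ->
  recursive b -> recursive (fun v => \sum_(i < b v) G i v).
Proof.
move=> rG rb; have := recursive_nat_rect (g := fun n r v => r + G n v)
  (recursive_const 0) _ rb.
have rg : recursive (fun v : k.+2.-tuple nat =>
    thead [tuple of behead v] +
    G (thead v) [tuple of behead [tuple of behead v]]).
  apply: recursiveD.
    by apply/recursive_thead/recursive_map_behead/recursive_map_id.
  pose h (v : k.+2.-tuple nat) :=
    [tuple of thead v :: [tuple of behead [tuple of behead v]]].
  have rh : recursive_map h.
    apply: recursive_map_cons; first exact/recursive_thead/recursive_map_id.
    by do 2![apply: recursive_map_behead]; exact: recursive_map_id.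
  apply: eq_recursive (recursive_app rG rh) => v.
  by rewrite theadE; congr G; exact: val_inj.
move=> /(_ rg); apply: eq_recursive => v.
by elim: (b v) => [|n /= ->]; rewrite ?big_ord0 ?big_ord_recr.
Qed.

(** A bounded universal statement holds exactly when the number of its counterexamples, a bounded
    sum, is zero. *)
Lemma recursive_forall k (P : nat -> k.-tuple nat -> bool)
    (b : k.-tuple nat -> nat) :
  recursive (fun v : k.+1.-tuple nat => P (thead v) [tuple of behead v]) ->
  recursive b -> recursive (fun v => [forall i : 'I_(b v), P i v]).
Proof.
move=> /recursive_negb rP rb.
have := recursive_eqn (recursive_sum (G := fun i v => ~~ P i v) rP rb)
  (recursive_const 0).
apply: eq_recursive => v; rewrite sum_nat_eq0; congr nat_of_bool.
by apply: eq_forallb => i; rewrite eqb0 negbK.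
Qed.

Lemma recursive_exists k (P : nat -> k.-tuple nat -> bool)
    (b : k.-tuple nat -> nat) :
  recursive (fun v : k.+1.-tuple nat => P (thead v) [tuple of behead v]) ->
  recursive b -> recursive (fun v => [exists i : 'I_(b v), P i v]).
Proof.
move=> /recursive_negb rP rb.
apply: eq_recursive (recursive_negb (recursive_forall (P := fun i v => ~~ P i v) rP rb)).
by move=> v; rewrite -negb_exists negbK.
Qed.

Lemma recursive_odd k (a : k.-tuple nat -> nat) :
  recursive a -> recursive (fun v => odd (a v)).
Proof.
move=> ra.
have rF : recursive (fun v : 1.-tuple nat => 1 - thead v).
  exact: recursiveB (recursive_const 1) (recursive_thead recursive_map_id).
apply: eq_recursive (recursive_iter rF ra (recursive_const 0)) => v.
by elim: (a v) => //= n ->; case: (odd n).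
Qed.

(** Half of n, rounded down, is the number of odd integers below n. *)
Lemma recursive_half k (a : k.-tuple nat -> nat) :
  recursive a -> recursive (fun v => (a v)./2).
Proof.
move=> ra.
have := recursive_sum (G := fun i (v : k.-tuple nat) => odd i)
  (recursive_odd (recursive_thead recursive_map_id)) ra.
apply: eq_recursive => v.
by elim: (a v) => [|n IHn]; rewrite ?big_ord0 // big_ord_recr /= IHn uphalf_half addnC.
Qed.

Lemma recursive_div_exp2 k (a b : k.-tuple nat -> nat) :
  recursive a -> recursive b -> recursive (fun v => a v %/ 2 ^ b v).
Proof.
move=> ra rb; have rhalf := recursive_half (recursive_thead (@recursive_map_id 1)).
apply: eq_recursive (recursive_iter rhalf rb ra) => v.
elim: (b v) => [|n /= ->]; first by rewrite divn1.
by rewrite -divn2 -divnMA expnSr.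
Qed.

Lemma recursive_cantor_pair k (a b : k.-tuple nat -> nat) :
  recursive a -> recursive b -> recursive (fun v => cantor_pair (a v) (b v)).
Proof.
move=> ra rb; apply: recursiveD => //; apply: recursive_half.
by apply: recursiveM; [|apply: recursiveS]; exact: recursiveD.
Qed.

(** * Prime exponents, codes of sequences, and sets enumerated through codes *)

Lemma recursive_logn k p (a : k.-tuple nat -> nat) :
  prime p -> recursive a -> recursive (fun v => logn p (a v).+1).
Proof.
move=> p_pr ra.
have rD : recursive (fun v : k.+1.-tuple nat =>
    [exists q : 'I_(a [tuple of behead v]).+2,
       (a [tuple of behead v]).+1 == q * p ^ (thead v).+1]).
  have rid m : recursive_map (fun v : m.-tuple nat => v) by exact: recursive_map_id.
  have rA : recursive (fun v : k.+1.-tuple nat => a [tuple of behead v]).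
    exact/(recursive_app ra)/recursive_map_behead.
  apply: (recursive_exists (P := fun q (v : k.+1.-tuple nat) =>
    (a [tuple of behead v]).+1 == q * p ^ (thead v).+1)); last first.
    by do 2![apply: recursiveS].
  apply: recursive_eqn.
    exact/recursiveS/(recursive_app rA)/recursive_map_behead.
  apply: recursiveM; first exact: recursive_thead.
  apply: recursive_exp; first exact: recursive_const.
  exact/recursiveS/recursive_thead/recursive_map_behead.
(* The exponent of [p] in [(a v).+1] counts the powers [p ^ i.+1] dividing it. A quotient is at most
   [(a v).+1], so divisibility is a bounded search. *)
have := recursive_sum (G := fun i v => [exists q : 'I_(a v).+2,
  (a v).+1 == q * p ^ i.+1]) rD ra.
apply: eq_recursive => v; rewrite logn_count_dvd // big_add1 big_mkord.
apply: eq_bigr => i _; congr nat_of_bool.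
apply/existsP/idP => [[q /eqP qE]|].
  by rewrite [X in _ %| X]qE dvdn_mull.
move=> /dvdnP[q qE]; have ltq : q < (a v).+2.
  by rewrite ltnS [leqRHS]qE leq_pmulr // expn_gt0 prime_gt0.
by exists (Ordinal ltq); rewrite /= -qE.
Qed.

(** The head of the sequence coded by [c] is the exponent of 2 in [c.+1], and the code of its tail
    is the exponent of 3. Every number is thus a code, and no length is stored. *)
Definition seq_entry (c i : nat) : nat :=
  logn 2 (iter i (fun c => logn 3 c.+1) c).+1.

Lemma recursive_seq_entry k (a b : k.-tuple nat -> nat) :
  recursive a -> recursive b -> recursive (fun v => seq_entry (a v) (b v)).
Proof.
move=> ra rb; apply: recursive_logn => //; apply: recursive_iter => //.
by apply: recursive_logn => //; exact/recursive_thead/recursive_map_id.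
Qed.

(** Induction on the length, for all [f] at once: if [c] codes the shifted sequence, then 2^(f 0)
    3^c - 1 codes [f]. *)
Lemma seq_entry_surj (f : nat -> nat) n :
  exists c, forall i, i < n -> seq_entry c i = f i.
Proof.
elim: n f => [|n IHn] f; first by exists 0.
have [c cE] := IHn (fun i => f i.+1).
have pos : 0 < 2 ^ f 0 * 3 ^ c by rewrite muln_gt0 !expn_gt0.
have log2 : logn 2 (2 ^ f 0 * 3 ^ c) = f 0.
  by rewrite lognM ?expn_gt0 // !lognX !logn_prime // muln0 muln1 addn0.
have log3 : logn 3 (2 ^ f 0 * 3 ^ c) = c.
  by rewrite lognM ?expn_gt0 // !lognX !logn_prime // muln0 muln1.
exists (2 ^ f 0 * 3 ^ c).-1 => -[_|i lt_in]; rewrite /seq_entry.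
  by rewrite /= prednK.
by rewrite iterSr prednK // log3; exact: cE.
Qed.

(** Unless no index satisfies [P], one accepted index [q0] is fixed and every rejected index is
    redirected to it; this leaves the range unchanged and the enumeration total. *)
Lemma recursively_enumerable_filter k (P : nat -> bool) (g : nat -> k.-tuple nat) :
  recursive (fun v : 1.-tuple nat => P (thead v)) ->
  (forall i, recursive (fun v : 1.-tuple nat => tnth (g (thead v)) i)) ->
  recursively_enumerable [set t | exists2 q, P q & t = g q].
Proof.
move=> rP rg; have [[q0 Pq0]|noP] := pselect (exists q, P q); last first.
  by left; rewrite -subset0 => t [q Pq _]; apply: noP; exists q.
right; exists (fun q => if P q then g q else g q0); split=> [i|].
  have := recursive_if rP (rg i) (recursive_const (tnth (g q0) i)).
  by apply: eq_recursive => v; case: (P _).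
apply/seteqP; split=> [t [q Pq ->]|t [q _ <-]]; first by exists q; rewrite ?Pq.
by case: ifP => Pq; [exists q|exists q0].
Qed.

Local Open Scope ring_scope.

(** * Cauchy names *)

Lemma half_expN2 (R : realType) n : 2 ^- n = 2 ^- n.+1 + 2 ^- n.+1 :> R.
Proof. by rewrite exprS invfM -mulrDl -[X in X + X]mul1r -splitr mul1r. Qed.

Lemma ler_expN2 (R : realType) m n : (m <= n)%N -> 2 ^- n <= 2 ^- m :> R.
Proof. by move=> le_mn; rewrite lef_pV2 ?posrE ?exprn_gt0 // ler_weXn2l // ler1n. Qed.

(** Let [k] tend to infinity in the Cauchy condition. That condition covers only [i < k], so [k] is
    taken beyond [i] as well as past the threshold for [e]. *)
Lemma cauchy_name_dist (R : realType) (X : effectiveMetricSpace R)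
    (f : nat -> nat) (xi : X) :
  cauchy_name f xi -> exists2 x : nat -> X,
    forall i, ems_notation X (f i) = Some (x i) &
    forall i, mdist (x i) xi <= 2 ^- i.
Proof.
move=> [x [fx xC xL]]; exists x => // i; apply/ler_addgt0Pr => e e0.
have [k [ik]] : exists k, (i < k)%N /\ mdist xi (x k) < e.
  have /cvg_ball /(_ e e0) [N _ HN] := xL.
  exists (maxn N i.+1); split; first by rewrite leq_max leqnn orbT.
  have := HN (maxn N i.+1); rewrite ballEmdist; apply.
  by rewrite /= leq_max leqnn.
rewrite metric_sym => /ltW xk.
by rewrite (le_trans (metric_triangle (x i) (x k) xi)) // lerD // xC.
Qed.

(** Halving the permitted error secures the Cauchy condition: two errors of at most 2^-(i+1) add up
    to at most 2^-i. *)
Lemma dist_cauchy_name (R : realType) (X : effectiveMetricSpace R)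
    (f : nat -> nat) (x : nat -> X) (xi : X) :
  (forall i, ems_notation X (f i) = Some (x i)) ->
  (forall i, mdist (x i) xi <= 2 ^- i.+1) -> cauchy_name f xi.
Proof.
move=> fx xd; exists x; split=> // [i k ik|].
  rewrite (le_trans (metric_triangle _ xi _)) // (half_expN2 R i) lerD //.
  by rewrite metric_sym (le_trans (xd k)) // ler_expN2 // ltnW.
apply/cvg_ballP => e e0; near=> n; rewrite ballEmdist /= metric_sym.
apply: (le_lt_trans (xd n)); near: n.
have := @cvg_geometric R 1 (2^-1).
rewrite ger0_norm ?invr_ge0 // invf_lt1 // ltr1n => /(_ isT).
move=> /cvgr0Pnorm_lt /(_ e e0) [N _ HN]; exists N => // n /= Nn.
have := HN n.+1 (leqW Nn); rewrite /= mul1r exprVn.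
by rewrite ger0_norm // invr_ge0 exprn_ge0.
Unshelve. all: by end_near. Qed.

Lemma exists_index_near (R : realType) (X : effectiveMetricSpace R) (xi : X)
    (e : R) :
  0 < e -> exists i x, ems_notation X i = Some x /\ mdist x xi <= e.
Proof.
move=> e0; have [x []] : ((ball xi (PosNum e0)%:num)° `&` ems_dense X) !=set0.
  apply: ems_denseP; last exact: (open_nbhs_ball xi (PosNum e0)).1.
  by exists xi; exact: (open_nbhs_ball xi (PosNum e0)).2.
move/interior_subset; rewrite ballEmdist /= ems_notation_onto => xe [i ix].
by exists i, x; rewrite metric_sym ltW.
Qed.

Lemma expN2_gt0 (R : realType) n : 0 < 2 ^- n :> R.
Proof. by rewrite invr_gt0 exprn_gt0. Qed.

(** The parameter [k] buys accuracy: [k = 0] suffices to continue a given prefix, while [k = 2]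
    makes initial segments of the name near prefixes of all points close enough to [xi]. *)
Lemma exists_cauchy_name (R : realType) (X : effectiveMetricSpace R) (xi : X) k :
  exists f x, [/\ forall i, ems_notation X (f i) = Some (x i),
    forall i, mdist (x i) xi <= 2 ^- (i + k).+1 & cauchy_name f xi].
Proof.
have /choice[fx fxP] : forall i, exists p : nat * X,
    ems_notation X p.1 = Some p.2 /\ mdist p.2 xi <= 2 ^- (i + k).+1.
  move=> i; have [j [x jx]] := exists_index_near xi (expN2_gt0 R (i + k).+1).
  by exists (j, x).
exists (fun i => (fx i).1), (fun i => (fx i).2); split=> [i|i|].
- exact: (fxP i).1.
- exact: (fxP i).2.
apply: dist_cauchy_name => i; first exact: (fxP i).1.
by rewrite (le_trans (fxP i).2) // ler_expN2 // ltnS leq_addr.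
Qed.

(** * The approximation system *)

(* The bound [2 ^ - k.+2] leaves room for a further error [2 ^ - k.+2] between
   [a] and the limit, so that [dist_cauchy_name] applies to extensions of [p]. *)
Definition near_prefix (R : realType) (X : effectiveMetricSpace R) (z : nat)
    (p : nat -> nat) (a : X) : Prop :=
  forall k, (k <= z)%N ->
    exists2 x, ems_notation X (p k) = Some x & mdist x a < 2 ^- k.+2.

(** Requiring [k <= w] loses nothing, since a pair code is at least its first component, and it
    bounds the search for [k]. *)
Definition within_graph (z : nat) (p : nat -> nat) : Prop :=
  forall w, canonical_finite_set z w ->
    exists2 k, (k <= w)%N & w = cantor_pair k (p k).

Definition operator_approximation (R : realType) (X Y : effectiveMetricSpace R)
    (W : set (3.-tuple nat)) : set (X * nat * Y * nat) :=
  [set t | let: (a, m, b, n) := t in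
    [/\ ems_dense X a, ems_dense Y b &
    exists z x y p, [/\ W [tuple z; x; y],
      near_prefix z p a, within_graph z p,
      (2 ^ z.+2 <= m.+1)%N /\ (2 * n + 2 <= 2 ^ x)%N &
      exists2 b', ems_notation Y y = Some b' &
        mdist b' b < (2 * n + 2)%N%:R^-1]]].

(** If 2^w exceeded z, the quotient would be 0, which is even; hence w < 2^w <= z. A query set of
    index z therefore reads only positions below z, and the prefix p_0, ..., p_z covers them. *)
Lemma canonical_finite_set_lt z w : canonical_finite_set z w -> (w < z)%N.
Proof.
rewrite /canonical_finite_set /= => zw; apply: leq_trans (ltn_expl w (ltnSn 1)) _.
by rewrite leqNgt; apply: contraTN zw => /divn_small ->.
Qed.

Lemma cantor_pair_ge k p : (k <= cantor_pair k p)%N.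
Proof.
rewrite /cantor_pair; have := leq_addr p k; lia.
Qed.

Lemma ems_dense_notation (R : realType) (X : effectiveMetricSpace R) i (a : X) :
  ems_notation X i = Some a -> ems_dense X a.
Proof. by rewrite ems_notation_onto; exists i. Qed.

Lemma natr_expN2 (R : realType) k : (2 ^ k)%N%:R^-1 = 2 ^- k :> R.
Proof. by rewrite natrX. Qed.

Lemma lef_natV (R : realType) m n :
  (0 < m)%N -> (m <= n)%N -> n%:R^-1 <= m%:R^-1 :> R.
Proof.
move=> m0 mn; rewrite lef_pV2 ?posrE ?ltr0n ?ler_nat //.
exact: leq_trans m0 mn.
Qed.

Lemma half_natV (R : realType) n :
  n.+1%:R^-1 = (2 * n + 2)%N%:R^-1 + (2 * n + 2)%N%:R^-1 :> R.
Proof.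
have -> : (2 * n + 2 = 2 * n.+1)%N by lia.
by rewrite natrM invfM -mulrDl -[X in X + X]mul1r -splitr mul1r.
Qed.

(** * Soundness and completeness of the approximation system *)

Section approximation.
Variables (R : realType) (X Y : effectiveMetricSpace R).
Variables (D : set X) (theta : D -> Y) (T : (nat -> option nat) -> nat -> option nat).
Variables (W : set (3.-tuple nat)).
Hypothesis TW : forall (f : nat -> option nat) (x y : nat),
  T f x = Some y <->
  exists2 z, W [tuple z; x; y] & canonical_finite_set z `<=` partial_graph f.
Hypothesis Ttheta : forall (xi : D) (f : nat -> nat), cauchy_name f (val xi) ->
  exists2 g : nat -> nat, T (fun i => Some (f i)) = (fun i => Some (g i)) &
    cauchy_name g (theta xi).

Lemma operator_approximation_sound (xi : D) a m b n :
  operator_approximation W (a, m, b, n) ->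
  mdist a (val xi) < m.+1%:R^-1 -> mdist b (theta xi) < n.+1%:R^-1.
Proof.
move=> [_ _ [z [x [y [p [Wzxy pa pz [zm nx] [b' yb' b'b]]]]]]] axi.
have [q [qx [qE qd _]]] := exists_cauchy_name (val xi) 0.
(* Follow the prefix up to [z], then an arbitrary accurate name of [xi]. *)
pose f k := if (k <= z)%N then p k else q k.
have [g Tf gname] : exists2 g : nat -> nat,
    T (fun i => Some (f i)) = (fun i => Some (g i)) & cauchy_name g (theta xi).
  apply: Ttheta.
  have /choice[fx fxP] : forall k, exists x,
      ems_notation X (f k) = Some x /\ mdist x (val xi) <= 2 ^- k.+1.
    move=> k; rewrite /f; case: leqP => kz; last first.
      by exists (qx k); split=> //; have := qd k; rewrite addn0.
    have [c pc ca] := pa k kz; exists c; split=> //.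
    (* Both legs are at most 2^-(k+2): the first by nearness of the prefix, the second because
       2^(k+2) <= 2^(z+2) <= m+1. *)
    rewrite (le_trans (metric_triangle _ a _)) // (half_expN2 R k.+1).
    apply: lerD; first exact: ltW.
    rewrite (le_trans (ltW axi)) // -natr_expN2 lef_natV ?expn_gt0 //.
    by apply: leq_trans zm; rewrite leq_exp2l // !ltnS.
  by apply: (dist_cauchy_name (x := fx)) => k; have [] := fxP k.
have gx : g x = y.
  have : T (fun i => Some (f i)) x = Some y.
    (* The query set lies in the graph of [f], because it concerns only positions where [f] agrees
       with [p]. *)
    apply/TW; exists z => // w zw; have [k kw ->] := pz w zw.
    exists k, (p k); split=> //; rewrite /f ifT //.
    by rewrite (leq_trans kw) // ltnW // canonical_finite_set_lt.
  by rewrite Tf => -[].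
have [gy gyE gyd] := cauchy_name_dist gname.
move: yb' b'b; rewrite -gx gyE => -[<-] bg.
rewrite (le_lt_trans (metric_triangle _ (gy x) _)) // half_natV metric_sym ltr_leD //.
by rewrite (le_trans (gyd x)) // -natr_expN2 lef_natV // addn2.
Qed.

Lemma operator_approximation_complete (xi : D) n :
  exists m, forall a, ems_dense X a -> mdist a (val xi) < m.+1%:R^-1 ->
  exists b : Y, operator_approximation W (a, m, b, n).
Proof.
(* The errors of this name are at most 2^-(i+3), half of what [near_prefix] allows; the other half
   is left for the distance from [a] to [xi]. *)
have [f [fx [fE fd fname]]] := exists_cauchy_name (val xi) 2.
have [g Tf gname] := Ttheta fname.
have [gy gyE gyd] := cauchy_name_dist gname.
(* Any position with 2n+2 <= 2^x would do; this one works since x < 2^x. *)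
pose x := (2 * n + 2)%N.
have /TW[z Wz zf] : T (fun i => Some (f i)) x = Some (g x) by rewrite Tf.
(* With this [m], the distance from [a] to [xi] is below 2^-(z+3), hence below 2^-(k+3) for all k <=
   z. The point [gy x] serves every such [a]. *)
exists (2 ^ z.+3)%N => a Xa axi; exists (gy x); split=> //.
  exact: ems_dense_notation (gyE x).
exists z, x, (g x), f; split=> //.
- move=> k kz; exists (fx k) => //.
  rewrite (le_lt_trans (metric_triangle _ (val xi) _)) // (half_expN2 R k.+2).
  apply: ler_ltD; first by have := fd k; rewrite addn2.
  rewrite metric_sym (lt_le_trans axi) // -natr_expN2 lef_natV ?expn_gt0 //.
  by rewrite leqW // leq_exp2l.
- move=> w /zf[k [c [-> [<-]]]]; exists k => //; exact: cantor_pair_ge.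
- split; first by rewrite leqW // leq_exp2l.
  by rewrite /x ltnW // ltn_expl.
- by exists (gy x) => //; rewrite mdistxx invr_gt0 ltr0n addn2.
Qed.

End approximation.

(** * Decidable codes for the quadruples of the system *)

Section enumeration.
Local Open Scope nat_scope.
Variables gX gY gW : nat -> 3.-tuple nat.

(* The entries of [q] are: a code of a sequence of witnesses for the closeness
   of [p k] to [a], an index in [W], a witness for the closeness of the value
   read off [W] to [b], and [m]. *)
Definition approximation_code (q : nat) : bool :=
  let c := seq_entry q 0 in let s := seq_entry q 1 in
  let u := seq_entry q 2 in let m := seq_entry q 3 in
  let z := nth 0 (gW s) 0 in
  [&& [forall k : 'I_z.+1,
         (nth 0 (gX (seq_entry c k)) 1 == nth 0 (gX (seq_entry c 0)) 1)
         && ((nth 0 (gX (seq_entry c k)) 2).+1 == 2 ^ k.+1)],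
      [forall w : 'I_z, odd (z %/ 2 ^ w) ==>
         [exists k : 'I_w.+1,
            w == cantor_pair k (nth 0 (gX (seq_entry c k)) 0) :> nat]],
      nth 0 (gY u) 0 == nth 0 (gW s) 2,
      2 ^ z.+2 <= m.+1 & 2 * nth 0 (gY u) 2 + 2 <= 2 ^ nth 0 (gW s) 1].

(** The index of [a] is read off the first closeness witness, as [approximation_code] makes the
    others share it. The precision [n] is the radius parameter of the witness from [gY]. *)
Definition approximation_of_code (q : nat) : 4.-tuple nat :=
  [tuple nth 0 (gX (seq_entry (seq_entry q 0) 0)) 1; seq_entry q 3;
         nth 0 (gY (seq_entry q 2)) 1; nth 0 (gY (seq_entry q 2)) 2].

Let recursive_components (g : nat -> 3.-tuple nat) := forall i : 'I_3,
  recursive (fun v : 1.-tuple nat => tnth (g (thead v)) i).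

Lemma recursive_nth (g : nat -> 3.-tuple nat) k (a : k.-tuple nat -> nat) i :
  recursive_components g -> i < 3 -> recursive a ->
  recursive (fun v => nth 0 (g (a v)) i).
Proof.
move=> rg i3 ra; apply: (recursive_app1 (F := fun n => nth 0 (g n) i)) => //.
by apply: eq_recursive (rg (Ordinal i3)) => v; rewrite (tnth_nth 0).
Qed.

Hypotheses (rX : recursive_components gX) (rY : recursive_components gY).
Hypothesis rW : recursive_components gW.

Ltac recursive_proj_tac := apply: recursive_thead;
  do ?[exact: recursive_map_id | apply: recursive_map_behead].

Ltac recursive_tac := repeat first
  [ exact: recursive_const
  | recursive_proj_tac
  | exact: rX | exact: rY | exact: rW | done
  | apply: recursive_andb | apply: recursive_implyb | apply: recursive_leq
  | apply: recursive_eqn | apply: recursive_odd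
  | apply: recursive_cantor_pair | apply: recursive_div_exp2
  | apply: recursive_exp | apply: recursiveD | apply: recursiveM
  | apply: recursive_nth | apply: recursive_seq_entry | apply: recursiveS ].

Lemma recursive_approximation_of_code i :
  recursive (fun v : 1.-tuple nat => tnth (approximation_of_code (thead v)) i).
Proof.
move: i; rewrite /approximation_of_code.
do 4![apply: recursive_map_cons; first by recursive_tac].
exact: recursive_map_nil.
Qed.

Lemma recursive_approximation_code :
  recursive (fun v : 1.-tuple nat => approximation_code (thead v)).
Proof.
rewrite /approximation_code /=; apply: recursive_andb.
  apply: (recursive_forall (P := fun k (v : 1.-tuple nat) =>
    let c := seq_entry (thead v) 0 in
    (nth 0 (gX (seq_entry c k)) 1 == nth 0 (gX (seq_entry c 0)) 1)
      && ((nth 0 (gX (seq_entry c k)) 2).+1 == 2 ^ k.+1))); recursive_tac.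
apply: recursive_andb; last by recursive_tac.
apply: (recursive_forall (P := fun w (v : 1.-tuple nat) =>
    odd (nth 0 (gW (seq_entry (thead v) 1)) 0 %/ 2 ^ w) ==>
      [exists k : 'I_w.+1,
         w == cantor_pair k
           (nth 0 (gX (seq_entry (seq_entry (thead v) 0) k)) 0) :> nat]));
  last by recursive_tac.
apply: recursive_implyb; first by recursive_tac.
(* Inside the outer quantifier, [w] is the head of the parameter tuple and the code is its second
   entry. *)
apply: (recursive_exists (P := fun k (v : 2.-tuple nat) =>
    thead v == cantor_pair k
      (nth 0 (gX (seq_entry (seq_entry (thead [tuple of behead v]) 0) k)) 0)
      :> nat)); recursive_tac.
Qed.

End enumeration.

(** Membership is certified by finitely many entries of the three enumerations. Packing their
    positions into one number exhibits the index set as the image of a decidable set of codes under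
    a recursive map. *)
Lemma recursively_enumerable_index_set (R : realType)
    (X Y : effectiveMetricSpace R) (W : set (3.-tuple nat)) :
  recursively_enumerable (close_indices X) ->
  recursively_enumerable (close_indices Y) ->
  recursively_enumerable W ->
  recursively_enumerable (index_set (@operator_approximation R X Y W)).
Proof.
(* A closeness triple ending in [r] certifies a distance below 1/(2r+2), so the radius 2^-(k+2)
   needs r+1 = 2^(k+1). *)
have radius k r : r.+1 = (2 ^ k.+1)%N -> (2 * r + 2)%N%:R^-1 = 2 ^- k.+2 :> R.
  by move=> rE; rewrite -natr_expN2 expnS -rE; congr (_%:R^-1); lia.
have prefix_index z p (a : X) i : near_prefix z p a ->
    ems_notation X i = Some a -> forall k, (k <= z)%N ->
    close_indices X [tuple p k; i; (2 ^ k.+1).-1].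
  move=> pa ia k kz; have [x px xa] := pa k kz.
  exists (p k), i, (2 ^ k.+1).-1, x, a; split=> //.
  by rewrite (radius k) // prednK // expn_gt0.
move=> reX reY reW.
(* One member of the index set yields members of both closeness sets and of [W], so all three have
   enumerating functions. *)
have [->|/set0P[t0 t0P]] := eqVneq (index_set (@operator_approximation R X Y W)) set0.
  by left.
have [i0 [m0 [j0 [n0 [a0 [b0 [_ i0E j0E [_ _ []]]]]]]]] := t0P.
move=> z0 [x0 [y0 [p0 [W0 pa0 _ _ [b0' y0E b0'b0]]]]].
have [X0|[gX [rX gXE]]] := reX.
  by have := prefix_index _ _ _ _ pa0 i0E 0%N isT; rewrite X0.
have [Y0|[gY [rY gYE]]] := reY.
  suff : close_indices Y [tuple y0; j0; n0] by rewrite Y0.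
  by exists y0, j0, n0, b0', b0.
have [W00|[gW [rW gWE]]] := reW; first by move: W0; rewrite W00.
suff -> : index_set (@operator_approximation R X Y W) =
    [set t | exists2 q, approximation_code gX gY gW q &
                        t = approximation_of_code gX gY q].
  apply: recursively_enumerable_filter.
    exact: recursive_approximation_code.
  exact: recursive_approximation_of_code.
apply/seteqP; split=> [t|t [q]].
  move=> [i [m [j [n [a [b [-> iE jE [_ _ [z [x [y [p []]]]]]]]]]]]].
  rewrite gWE => -[s _ sE] pa pz [zm nx] [b' yE b'b].
  (* Choose a position in the enumeration [gX] for each closeness triple of the prefix; the value 0
     beyond [z] is arbitrary. *)
  have /choice[e eE] : forall k, exists e, (k <= z)%N ->
      gX e = [tuple p k; i; (2 ^ k.+1).-1].
    move=> k; case: (leqP k z) => kz; last by exists 0%N.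
    have := prefix_index _ _ _ _ pa iE k kz.
    by rewrite gXE => -[e0 _ e0E]; exists e0.
  have [u uE] : exists u, gY u = [tuple y; j; n].
    have : close_indices Y [tuple y; j; n] by exists y, j, n, b', b.
    by rewrite gYE => -[u0 _ u0E]; exists u0.
  have [c cE] := seq_entry_surj e z.+1.
  have [q qE] := seq_entry_surj (nth 0%N [:: c; s; u; m]) 4.
  have q0 := qE 0%N isT; have q1 := qE 1%N isT.
  have q2 := qE 2%N isT; have q3 := qE 3%N isT.
  rewrite /= in q0 q1 q2 q3.
  have gXc k : (k <= z)%N -> gX (seq_entry c k) = [tuple p k; i; (2 ^ k.+1).-1].
    by move=> kz; rewrite cE // eE.
  exists q; last by rewrite /approximation_of_code q0 q2 q3 gXc // uE.
  rewrite /approximation_code q0 q1 q2 q3 sE uE /= zm nx eqxx !andbT /=.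
  apply/andP; split.
    apply/forallP => k; rewrite !gXc //= ?eqxx /=; last by rewrite -ltnS.
    by rewrite prednK // expn_gt0.
  apply/forallP => w; apply/implyP => /pz[k kw wE].
  apply/existsP; exists (Ordinal (kw : (k < w.+1)%N)) => /=.
  by rewrite gXc ?(leq_trans kw (ltnW (ltn_ord w))) //= -wE.
rewrite /approximation_code /approximation_of_code.
set c := seq_entry q 0; set s := seq_entry q 1.
set u := seq_entry q 2; set m := seq_entry q 3; set z := nth 0%N (gW s) 0.
case/and5P=> /forallP hk /forallP hw /eqP hy hm hn ->.
have gX_close e : close_indices X (gX e) by rewrite gXE; exists e.
have [y [j [n [b' [b [uE yE jE b'b]]]]]] : close_indices Y (gY u).
  by rewrite gYE; exists u.
(* The witness for k = 0 determines the index [i] and the point [a]. *)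
have [p [i [r [x [a [eE pE iE xa]]]]]] := gX_close (seq_entry c 0).
rewrite uE eE /= in hk hy hn *.
exists i, m, j, n, a, b; split=> //; split; try exact: ems_dense_notation.
  exact: (ems_dense_notation iE).
  exact: (ems_dense_notation jE).
(* The prefix consists of the first entries of the coded closeness triples. *)
exists z, (nth 0%N (gW s) 1), y, (fun k => nth 0%N (gX (seq_entry c k)) 0).
split=> //.
- rewrite gWE; exists s => //; apply: eq_from_tnth => l.
  rewrite !(tnth_nth 0%N) /=; case: l => -[|[|[|//]]] //= _.
- move=> k kz; have := hk (Ordinal (kz : (k < z.+1)%N)) => /=.
  have [p' [i' [r' [x' [a' [-> p'E i'E x'a']]]]]] := gX_close (seq_entry c k).
  move=> /= /andP[/eqP ii' /eqP rE]; exists x' => //.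
  (* The notation is single-valued, so equal second indices force the same point [a] for every k. *)
  move: i'E; rewrite ii' iE => -[->]; rewrite -(radius _ _ rE); exact: x'a'.
- move=> w zw; have := implyP (hw (Ordinal (canonical_finite_set_lt zw))) zw.
  case/existsP=> k /eqP wE; exists k => //; first by rewrite -ltnS.
- by exists b'.
Qed.

Theorem theorem3 (R : realType) (X Y : effectiveMetricSpace R)
    (D : set X) (theta : D -> Y) :
  recursively_enumerable (close_indices X) ->
  recursively_enumerable (close_indices Y) ->
  representation_computable theta ->
  exists S : set (X * nat * Y * nat),
    approximation_system theta S /\ recursively_enumerable (index_set S).
Proof.
move=> reX reY [T [W reW TW] Ttheta].
exists (operator_approximation W); split; last first.
  exact: recursively_enumerable_index_set.
split=> [a m b n [aA bB _] //|xi]; split=> [a m b n|n].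
  exact: operator_approximation_sound TW Ttheta _ _ _ _ _.
exact: operator_approximation_complete TW Ttheta _ _.
Qed.
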